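(* Let $0\le v_i^l\le v_i^u$, $0\le v_j^l\le v_j^u$ and $-\pi/2<\theta_{ij}^l<\theta_{ij}^u<\pi/2$ be real constants, and put $$\phi_{ij}=\tfrac{\theta_{ij}^u+\theta_{ij}^l}{2},\qquad \delta_{ij}=\tfrac{\theta_{ij}^u-\theta_{ij}^l}{2},\qquad v_i^\sigma=v_i^l+v_i^u .$$ Then every point $(w^R_{ij},w^I_{ij},w_i,w_j)\in\mathbb{R}^4$ of the non-convex voltage feasibility set (defined in the context) satisfies $$ v_j^l\cos(\delta_{ij})\,w_i - v_i^\sigma\cos(\phi_{ij})\,w^R_{ij} - v_i^\sigma\sin(\phi_{ij})\,w^I_{ij} + v_i^l v_i^u v_j^l\cos(\delta_{ij})\le 0 .$$ That is, this linear inequality (the ''Extreme cut'') is redundant for that set.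
   Context: The non-convex voltage feasibility set for the constants $v_i^l,v_i^u,v_j^l,v_j^u,\theta^l_{ij},\theta^u_{ij}$ is the set of all $(w^R_{ij},w^I_{ij},w_i,w_j)\in\mathbb{R}^4$ such that (1) $(v_i^l)^2\le w_i\le (v_i^u)^2$; (2) $(v_j^l)^2\le w_j\le (v_j^u)^2$; (3) $w^{Rl}_{ij}\le w^R_{ij}\le w^{Ru}_{ij}$; (4) $w^{Il}_{ij}\le w^I_{ij}\le w^{Iu}_{ij}$; (5) $\tan(\theta^l_{ij})w^R_{ij}\le w^I_{ij}\le\tan(\theta^u_{ij})w^R_{ij}$; (6) $(w^R_{ij})^2+(w^I_{ij})^2=w_iw_j$. The bounds in (3),(4) are the following constants. If $\theta^l_{ij},\theta^u_{ij}\le 0$: $w^{Rl}_{ij}=v^l_iv^l_j\cos\theta^l_{ij}$, $w^{Ru}_{ij}=v^u_iv^u_j\cos\theta^u_{ij}$, $w^{Il}_{ij}=v^u_iv^u_j\sin\theta^l_{ij}$, $w^{Iu}_{ij}=v^l_iv^l_j\sin\theta^u_{ij}$. If $\theta^l_{ij},\theta^u_{ij}\ge 0$: $w^{Rl}_{ij}=v^l_iv^l_j\cos\theta^u_{ij}$, $w^{Ru}_{ij}=v^u_iv^u_j\cos\theta^l_{ij}$, $w^{Il}_{ij}=v^l_iv^l_j\sin\theta^l_{ij}$, $w^{Iu}_{ij}=v^u_iv^u_j\sin\theta^u_{ij}$. If $\theta^l_{ij}<0<\theta^u_{ij}$: $w^{Rl}_{ij}=v^l_iv^l_j\min(\cos\theta^l_{ij},\cos\theta^u_{ij})$,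 $w^{Ru}_{ij}=v^u_iv^u_j$, $w^{Il}_{ij}=v^u_iv^u_j\sin\theta^l_{ij}$, $w^{Iu}_{ij}=v^u_iv^u_j\sin\theta^u_{ij}$. A constraint is redundant for a set if every point of the set satisfies it. *)

(* Defs.v *)
From mathcomp Require Import all_boot all_order all_algebra.
From mathcomp Require Import classical_sets reals trigo.

Set Implicit Arguments.
Unset Strict Implicit.
Unset Printing Implicit Defensive.

Import Order.TTheory GRing.Theory Num.Theory.
Local Open Scope ring_scope.
Local Open Scope classical_set_scope.

(* The voltage limits are (vil, viu) at bus i and (vjl, vju) at bus j, and the
   phase-angle-difference limits are (thl, thu). *)

(* The third branch of each bound is meant for thl < 0 < thu; since the angle
   limits are always taken with thl < thu, the three cases are then exclusive
   and exhaustive. *)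
Definition wR_lower (R : realType) (vil viu vjl vju thl thu : R) : R :=
  if (thl <= 0) && (thu <= 0) then vil * vjl * cos thl
  else if (0 <= thl) && (0 <= thu) then vil * vjl * cos thu
  else vil * vjl * Num.min (cos thl) (cos thu).

Definition wR_upper (R : realType) (vil viu vjl vju thl thu : R) : R :=
  if (thl <= 0) && (thu <= 0) then viu * vju * cos thu
  else if (0 <= thl) && (0 <= thu) then viu * vju * cos thl
  else viu * vju.

Definition wI_lower (R : realType) (vil viu vjl vju thl thu : R) : R :=
  if (thl <= 0) && (thu <= 0) then viu * vju * sin thl
  else if (0 <= thl) && (0 <= thu) then vil * vjl * sin thl
  else viu * vju * sin thl.

Definition wI_upper (R : realType) (vil viu vjl vju thl thu : R) : R :=
  if (thl <= 0) && (thu <= 0) then vil * vjl * sin thu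
  else if (0 <= thl) && (0 <= thu) then viu * vju * sin thu
  else viu * vju * sin thu.

Definition voltage_feasibility_set (R : realType)
    (vil viu vjl vju thl thu : R) : set (R * R * R * R) :=
  [set w | let: (wR, wI, wi, wj) := w in
    [/\ vil ^+ 2 <= wi <= viu ^+ 2,
        vjl ^+ 2 <= wj <= vju ^+ 2,
        wR_lower vil viu vjl vju thl thu <= wR
          <= wR_upper vil viu vjl vju thl thu,
        wI_lower vil viu vjl vju thl thu <= wI
          <= wI_upper vil viu vjl vju thl thu &
        tan thl * wR <= wI <= tan thu * wR
        /\ wR ^+ 2 + wI ^+ 2 = wi * wj]].

(* Main.v *)
(* In polar form w^R + i w^I = r e^{i t} with r^2 = w_i w_j, and the angle
   constraints say |t - phi| <= delta. Hence the projection
   p = w^R cos phi + w^I sin phi = r cos (t - phi) is at least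
   cos delta * sqrt w_i * v_j^l, and the cut reduces to
   (sqrt w_i - v_i^l) (sqrt w_i - v_i^u) <= 0. *)

Require Import Defs.
From mathcomp Require Import all_boot all_order all_algebra.
From mathcomp Require Import classical_sets reals trigo.
From mathcomp Require Import ring lra.

Set Implicit Arguments.
Unset Strict Implicit.
Unset Printing Implicit Defensive.

Import Order.TTheory GRing.Theory Num.Theory.
Local Open Scope ring_scope.
Local Open Scope classical_set_scope.

(** Rotate the axes by [phi]: with p along the bisector of the sector and q across it, the two
    hypotheses become |cos delta * q| <= sin delta * p. Squaring this and adding (cos delta * p)^2
    to both sides gives the bound. *)
Lemma projection_ge_cos (R : realType) (x y phi delta : R) :
  0 < sin delta ->
  sin (phi - delta) * x <= cos (phi - delta) * y ->
  cos (phi + delta) * y <= sin (phi + delta) * x ->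
  0 <= cos phi * x + sin phi * y /\
  cos delta ^+ 2 * (x ^+ 2 + y ^+ 2) <= (cos phi * x + sin phi * y) ^+ 2.
Proof.
move=> sd; rewrite sinB cosB sinD cosD => hl hu.
set p := cos phi * x + sin phi * y.
pose q := cos phi * y - sin phi * x.
have h1 : 0 <= sin delta * p + cos delta * q by rewrite /p /q; lra.
have h2 : 0 <= sin delta * p - cos delta * q by rewrite /p /q; lra.
(* The sum of [h1] and [h2] is 2 * sin delta * p. *)
have p0 : 0 <= p by rewrite -(pmulr_rge0 _ sd); lra.
split=> //.
have -> : x ^+ 2 + y ^+ 2 = p ^+ 2 + q ^+ 2.
  rewrite -[LHS]mul1r -(cos2Dsin2 phi) /p /q; ring.
(* The product of the two factors is (sin delta * p)^2 - (cos delta * q)^2. *)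
have := mulr_ge0 h2 h1; rewrite -subr_sqr !exprMn.
have -> : sin delta ^+ 2 = 1 - cos delta ^+ 2.
  by rewrite -(cos2Dsin2 delta) addrC addKr.
lra.
Qed.

Theorem theorem4p1 (R : realType) (vil viu vjl vju thl thu : R)
    (hvil : 0 <= vil) (hvi : vil <= viu)
    (hvjl : 0 <= vjl) (hvj : vjl <= vju)
    (hthl : - (pi / 2) < thl) (hth : thl < thu) (hthu : thu < pi / 2) :
  let phi := (thu + thl) / 2 in
  let delta := (thu - thl) / 2 in
  let visigma := vil + viu in
  voltage_feasibility_set vil viu vjl vju thl thu `<=`
  [set w : R * R * R * R | let: (wR, wI, wi, wj) := w in
    vjl * cos delta * wi - visigma * cos phi * wR - visigma * sin phi * wI
      + vil * viu * vjl * cos delta <= 0].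
Proof.
move=> phi delta visigma [[[wR wI] wi] wj] /=.
move=> [/andP[wil wiu] /andP[wjl _] _ _ [/andP[tl tu] wE]].
have cl : 0 < cos thl by apply: cos_gt0_pihalf; lra.
have cu : 0 < cos thu by apply: cos_gt0_pihalf; lra.
have cd : 0 < cos delta by apply: cos_gt0_pihalf; rewrite /delta; lra.
have sd : 0 < sin delta by apply: sin_gt0_pi; rewrite /delta; lra.
have thlE : phi - delta = thl by rewrite /phi /delta; lra.
have thuE : phi + delta = thu by rewrite /phi /delta; lra.
(* Multiplying by the positive cosine clears the tangent from each angle constraint. *)
have hl : sin (phi - delta) * wR <= cos (phi - delta) * wI.
  by rewrite thlE -ler_pdivrMl // mulrA (mulrC _^-1).
have hu : cos (phi + delta) * wI <= sin (phi + delta) * wR.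
  by rewrite thuE -ler_pdivlMl // mulrA (mulrC _^-1).
have [p0 p2] := projection_ge_cos sd hl hu.
have wi0 : 0 <= wi by apply: le_trans wil; rewrite sqr_ge0.
pose s := Num.sqrt wi.
have s0 : 0 <= s by rewrite sqrtr_ge0.
have s2 : s ^+ 2 = wi by rewrite sqr_sqrtr.
have sl : vil <= s by rewrite -(@ler_pXn2r _ 2) ?nnegrE // s2.
have su : s <= viu.
  by rewrite -(@ler_pXn2r _ 2) ?nnegrE ?s2 //; exact: le_trans hvi.
have cvs : 0 <= cos delta * (vjl * s) by rewrite !mulr_ge0 // ltW.
(* Both sides are nonnegative, so squares are compared: vjl^2 * wi <= wj * wi = wR^2 + wI^2, and
   [p2] bounds the latter times cos(delta)^2. *)
have ps : cos delta * (vjl * s) <= cos phi * wR + sin phi * wI.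
  rewrite -(@ler_pXn2r _ 2) ?nnegrE //; apply: le_trans p2.
  by rewrite wE !exprMn s2 mulrC [leRHS]mulrC ler_wpM2r ?sqr_ge0 // mulrC ler_wpM2l.
have vs0 : 0 <= visigma by rewrite addr_ge0 // (le_trans hvil).
have := ler_wpM2l vs0 ps.
(* As [s] lies in [vil, viu], s^2 + vil * viu <= visigma * s. Scaled by cos delta * vjl, its right
   side is the left side of [ps] times [visigma], so the two inequalities chain to the cut. *)
have : cos delta * vjl * ((s - vil) * (s - viu)) <= 0.
  by rewrite mulr_ge0_le0 ?mulr_ge0_le0 ?mulr_ge0 ?subr_ge0 ?subr_le0 // ltW.
rewrite -s2 /visigma; lra.
Qed.
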